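(* Let $V_0\in\mathscr V^{\rm irr}$ and let $|\varphi\rangle\in\mathcal H$ be a unit vector (initial system state). Let $A,B\in B_\epsilon(V_0)\subset T_{V_0}(\mathscr V^{\rm irr})$ and let $F_{V_0,n}(A,B)$ be the quantum Fisher information of the system-output state $|\Psi_V(n)\rangle=V(n)|\varphi\rangle$ at $V_0$ in the directions $A,B$. Then $$\lim_{n\to+\infty}\frac{F_{V_0,n}(A,B)}{n}=F_{V_0}(A^{\rm id},B^{\rm id}),$$ where $F_{V_0}(X,Y):=4\,{\rm Re}\,{\rm Tr}(\rho^{\rm ss}_{V_0}X^*Y)$ for $X,Y\in T^{\rm id}_{V_0}$ and $A^{\rm id},B^{\rm id}$ are the identifiable components of $A,B$.
   Context: $\mathcal H=\mathbb C^d$, $\mathcal K=\mathbb C^k$. For an isometry $V:\mathcal H\to\mathcal H\otimes\mathcal K$, write $V|\psi\rangle=\sum_iK_i|\psi\rangle\otimes|i\rangle$; the channel is $\mathcal T_V(X)=V^*(X\otimes\mathbf 1_{\mathcal K})V$, with predual $\mathcal T_{V*}(\rho)=\sum_iK_i\rho K_i^*$; $V$ is irreducible if there is a unique state $\rho_V^{\rm ss}>0$ with $\mathcal T_{V*}(\rho^{\rm ss}_V)=\rho_V^{\rm ss}$ (non-trivial period is allowed). $\mathscr V^{\rm irr}$ is the manifold of irreducible isometries. $V(n)|\varphi\rangle=\sum_{i_1,\dots,i_n}K_{i_n}\cdots K_{i_1}|\varphi\rangle\otimes|i_1\cdots i_n\rangle$. Tangent space convention: $T_V(\mathscr V^{\rm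 irr})=\{L\in L^\infty(\mathcal H,\mathcal H\otimes\mathcal K):L^*V-V^*L=0\}$, where $L$ represents the infinitesimal change $V\mapsto V+i\delta L$ ($\delta$ real). It is the direct sum of $T_V^{\rm nonid}=\{\theta V-(K\otimes\mathbf 1_{\mathcal K})V+VK:\theta\in\mathbb R,\ K=K^*\in L^\infty(\mathcal H),\ {\rm Tr}(\rho_V^{\rm ss}K)=0\}$ and $T_V^{\rm id}=\{A\in L^\infty(\mathcal H,\mathcal H\otimes\mathcal K):VV^*A=0\}$; $A=A^{\rm id}+A^{\rm nonid}$ is the corresponding decomposition. $B_\epsilon(V_0)$ is an open ball centred at $0$ in $T_{V_0}(\mathscr V^{\rm irr})$. The quantum Fisher information of the pure-state model is the real symmetric bilinear form $F_{V_0,n}(A,B)=4\,{\rm Re}\big(\langle\partial_A\Psi|\partial_B\Psi\rangle-\langle\partial_A\Psi|\Psi\rangle\langle\Psi|\partial_B\Psi\rangle\big)$, with $\Psi=\Psi_{V_0}(n)$ and $\partial_A\Psi$ the derivative of $V\mapsto V(n)|\varphi\rangle$ at $V_0$ along the tangent vector $iA$. *)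

(* Defs.v *)
From mathcomp Require Import all_boot all_order all_algebra.
From mathcomp Require Import complex mxtens.
From mathcomp Require Import all_classical all_reals topology normedtype derive.

Set Implicit Arguments.
Unset Strict Implicit.
Unset Printing Implicit Defensive.

Import Order.TTheory GRing.Theory Num.Theory.
Import numFieldNormedType.Exports.

Local Open Scope classical_set_scope.
Local Open Scope complex_scope.
Local Open Scope ring_scope.

Definition adjmx (R : realType) (m n : nat) (A : 'M[R[i]]_(m, n)) :
  'M[R[i]]_(n, m) := map_mx Num.conj A^T.

(* The order on R[i] is partial: 0 <= z means that z is real and nonnegative,
   so both predicates entail that rho is Hermitian. *)
Definition posmx (R : realType) (d : nat) (rho : 'M[R[i]]_d) : Prop :=
  forall v : 'cV[R[i]]_d, 0 <= (adjmx v *m rho *m v) 0 0.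

Definition posdefmx (R : realType) (d : nat) (rho : 'M[R[i]]_d) : Prop :=
  forall v : 'cV[R[i]]_d, v != 0 -> 0 < (adjmx v *m rho *m v) 0 0.

Definition is_state (R : realType) (d : nat) (rho : 'M[R[i]]_d) : Prop :=
  posmx rho /\ \tr rho = 1.

(* A linear map C^d -> C^d (x) C^k is a (d * k) x d matrix; the basis vector
   |a> (x) |i> has index mxtens_index (a, i), the indexing used by *t. *)
Definition is_isometry (R : realType) (d k : nat) (V : 'M[R[i]]_(d * k, d)) :
  Prop := adjmx V *m V = 1%:M.

Definition kraus (R : realType) (d k : nat) (V : 'M[R[i]]_(d * k, d))
  (i : 'I_k) : 'M[R[i]]_d := \matrix_(a, b) V (mxtens_index (a, i)) b.

Definition predual (R : realType) (d k : nat) (V : 'M[R[i]]_(d * k, d))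
  (rho : 'M[R[i]]_d) : 'M[R[i]]_d :=
  \sum_(i < k) kraus V i *m rho *m adjmx (kraus V i).

Definition faithful_stationary (R : realType) (d k : nat)
  (V : 'M[R[i]]_(d * k, d)) (rho : 'M[R[i]]_d) : Prop :=
  [/\ is_state rho, posdefmx rho & predual V rho = rho].

(* If rho is faithful and stationary and sigma is any stationary state, then
   (rho + sigma) / 2 is faithful and stationary; hence uniqueness among faithful
   stationary states is the same as uniqueness among all stationary states. *)
Definition irreducible (R : realType) (d k : nat) (V : 'M[R[i]]_(d * k, d)) :
  Prop := exists! rho : 'M[R[i]]_d, faithful_stationary V rho.

Definition rho_ss (R : realType) (d k : nat) (V : 'M[R[i]]_(d * k, d)) :
  'M[R[i]]_d := xget 0 [set rho | faithful_stationary V rho].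

(* A tangent vector L stands for the infinitesimal change V + i delta L. *)
Definition tangent (R : realType) (d k : nat) (V : 'M[R[i]]_(d * k, d)) :
  set 'M[R[i]]_(d * k, d) :=
  [set L | adjmx L *m V - adjmx V *m L = 0].

Definition tangent_nonid (R : realType) (d k : nat)
  (V : 'M[R[i]]_(d * k, d)) : set 'M[R[i]]_(d * k, d) :=
  [set L | exists (theta : R) (K : 'M[R[i]]_d),
     [/\ adjmx K = K, \tr (rho_ss V *m K) = 0 &
         L = theta%:C *: V - (K *t (1%:M : 'M[R[i]]_k)) *m V + V *m K]].

Definition tangent_id (R : realType) (d k : nat)
  (V : 'M[R[i]]_(d * k, d)) : set 'M[R[i]]_(d * k, d) :=
  [set A | V *m adjmx V *m A = 0].

(* The component of A in tangent_id V along tangent_nonid V. *)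
Definition idpart (R : realType) (d k : nat) (V A : 'M[R[i]]_(d * k, d)) :
  'M[R[i]]_(d * k, d) :=
  xget 0 [set X | tangent_id V X /\ tangent_nonid V (A - X)].

Definition hsnorm (R : realType) (m n : nat) (A : 'M[R[i]]_(m, n)) : R :=
  Num.sqrt (complex.Re (\tr (adjmx A *m A))).

Definition tangent_ball (R : realType) (d k : nat)
  (V : 'M[R[i]]_(d * k, d)) (eps : R) : set 'M[R[i]]_(d * k, d) :=
  [set A | tangent V A /\ hsnorm A < eps].

(* The space C^d (x) (C^k)^(x)n, identified with the C^d-valued functions on
   output sequences: Psi = \sum_t Psi t (x) |t_1 ... t_n>. *)
Definition sysout (R : realType) (d k n : nat) : Type :=
  {ffun n.-tuple 'I_k -> 'cV[R[i]]_d}.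

Definition braket (R : realType) (d k n : nat) (Psi Phi : sysout R d k n) :
  R[i] := \sum_(t : n.-tuple 'I_k) (adjmx (Psi t) *m Phi t) 0 0.

(* foldl applies the operator of the first output first:
   the t-component is K_(t_n) ... K_(t_1) phi. *)
Definition sysout_state (R : realType) (d k n : nat) (phi : 'cV[R[i]]_d)
  (V : 'M[R[i]]_(d * k, d)) : sysout R d k n :=
  [ffun t : n.-tuple 'I_k => foldl (fun psi i => kraus V i *m psi) phi t].

(* Derivative of a complex-valued function of a real variable. *)
Definition cderive1 (R : realType) (f : R -> R[i]) (x : R) : R[i] :=
  @Complex R (derive1 (fun u : R => complex.Re (f u)) x)
             (derive1 (fun u : R => complex.Im (f u)) x).

(* The derivative of V |-> V(n) phi along i A, coordinate by coordinate. The
   map is polynomial in V and defined for every V, so it may be computed along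
   the line V + delta (i A), delta real. *)
Definition dsysout_state (R : realType) (d k n : nat) (phi : 'cV[R[i]]_d)
  (V A : 'M[R[i]]_(d * k, d)) : sysout R d k n :=
  [ffun t : n.-tuple 'I_k => \col_(a < d)
     cderive1 (fun delta : R =>
       sysout_state n phi (V + (0 +i* delta) *: A) t a 0) 0].

Definition qfi (R : realType) (d k n : nat) (phi : 'cV[R[i]]_d)
  (V A B : 'M[R[i]]_(d * k, d)) : R :=
  let Psi := sysout_state n phi V in
  let dA := dsysout_state n phi V A in
  let dB := dsysout_state n phi V B in
  4 * complex.Re (braket dA dB - braket dA Psi * braket Psi dB).

Definition qfi_rate (R : realType) (d k : nat) (V X Y : 'M[R[i]]_(d * k, d)) :
  R := 4 * complex.Re (\tr (rho_ss V *m adjmx X *m Y)).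

(* Main.v *)
Require Import Defs.
From HB Require Import structures.
From mathcomp Require Import all_boot all_order all_algebra.
From mathcomp Require Import complex mxtens ring.
From mathcomp Require Import all_classical all_reals topology normedtype derive.

(* Differentiating V(n) phi along i A gives i D_n(A), with
   D_n(A) = \sum_j V ... V A V ... V phi. If A = X + theta V - (K (x) 1) V + V K
   with V^* X = 0, the nonidentifiable terms telescope:
     D_n(A) = D_n(X) + n theta Psi_n + r_n,   r_n = V(n) K phi - K Psi_n.
   The term n theta Psi_n drops out of the covariance and r_n is bounded. Since
   V^* X = V^* Y = 0, one has <Psi_n|D_n(X)> = 0 and
   <D_n(X)|D_n(Y)> = \sum_(j < n) <Psi_j|X^* Y Psi_j>. The cross terms are
   O(sqrt n) by Cauchy-Schwarz. Writing T for the channel in the Heisenberg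
   picture, X^* Y = Tr(rho X^* Y) 1 + (N - T(N)) for some N, so that the sum is
   n Tr(rho X^* Y) + <phi|N phi> - <Psi_n|N Psi_n>, with bounded remainder.
   The equation N - T(N) = M is solvable as soon as Tr(rho M) = 0, because the
   fixed points of the predual are the multiples of rho; it also yields the
   decomposition of tangent vectors. *)

Set Implicit Arguments.
Unset Strict Implicit.
Unset Printing Implicit Defensive.

Import Order.TTheory GRing.Theory Num.Theory.
Import numFieldNormedType.Exports.

Local Open Scope classical_set_scope.
Local Open Scope complex_scope.
Local Open Scope ring_scope.

(** The expression is a form evaluated at [u + z v]. Reality at [z = 1] and [z = 'i] forces
    [b' = b^*], so hermitian symmetry is derived and not assumed; the inequality follows by
    minimising over [z = - s * b^*] with [s] real. *)
Lemma cauchy_schwarz_quadratic (C : numClosedFieldType) (a b b' c : C) :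
    0 <= c -> (forall z, 0 <= a + z * b + z^* * b' + z^* * z * c) ->
  b' = b^* /\ `|b| ^+ 2 <= a * c.
Proof.
move=> c0 H.
have a0 : 0 <= a by have := H 0; rewrite conjC0 !mul0r !addr0.
have aR : a \is Num.real by apply: ger0_real.
have cR : c \is Num.real by apply: ger0_real.
have bb' : b' = b^*.
  have r1 : b + b' \is Num.real.
    have -> : b + b' = a + 1 * b + 1^* * b' + 1^* * 1 * c - (a + c).
      by rewrite conjC1; ring.
    by apply: rpredB; [exact/ger0_real/H | exact: rpredD].
  have r2 : 'i * (b - b') \is Num.real.
    have -> : 'i * (b - b') =
        a + 'i * b + 'i^* * b' + 'i^* * 'i * c - (a + c).
      have e : - 'i * 'i = 1 :> C by rewrite mulNr -expr2 sqrCi opprK.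
      by rewrite conjCi e; ring.
    by apply: rpredB; [exact/ger0_real/H | exact: rpredD].
  move/CrealP: r1; rewrite rmorphD /= => r1.
  move/CrealP: r2; rewrite rmorphM /= conjCi rmorphB /= mulNr -mulrN.
  move/(mulfI (neq0Ci C)) => r2.
  apply: (mulfI (_ : 2 != 0 :> C)); first by rewrite pnatr_eq0.
  have -> : 2 * b' = (b + b') - (b - b') by ring.
  by rewrite -r1 -r2; ring.
split=> //.
have key s : s \is Num.real ->
    0 <= a - 2 * s * `|b| ^+ 2 + s ^+ 2 * `|b| ^+ 2 * c.
  move=> /CrealP sR; have := H (- s * b^*).
  rewrite bb' rmorphM /= rmorphN /= sR conjCK normCK.
  by congr (_ <= _); ring.
have [c1|cN0] := eqVneq c 0.
  rewrite c1 mulr0; case: (eqVneq b 0) => [->|b0]; first by rewrite normr0 expr0n.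
  have n0 : `|b| ^+ 2 != 0 by rewrite expf_neq0// normr_eq0.
  have nR : `|b| ^+ 2 \is Num.real by rewrite rpredX// normr_real.
  (* With [c = 0] the expression is affine in [s]; this [s] gives it the negative value
     [- (a + 2)]. *)
  have := key ((a + 1) / `|b| ^+ 2) _; rewrite c1 mulr0 addr0.
  have -> : a - 2 * ((a + 1) / `|b| ^+ 2) * `|b| ^+ 2 = - (a + 2).
    by field; rewrite normr_eq0.
  have ap : 0 < a + 2 by rewrite ltr_wpDl.
  rewrite rpredM ?rpredV ?rpredD ?rpred1// => /(_ isT).
  by rewrite oppr_ge0 => /(lt_le_trans ap); rewrite ltxx.
have cp : 0 < c by rewrite lt_def cN0.
have := key c^-1; rewrite rpredV => /(_ cR).
have -> : a - 2 * c^-1 * `|b| ^+ 2 + c^-1 ^+ 2 * `|b| ^+ 2 * c = a - `|b| ^+ 2 / c.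
  by field.
by rewrite subr_ge0 ler_pdivrMr.
Qed.

(** * Adjoints, the hermitian product on columns, positive matrices *)

Section adjoint.
Context {R : realType}.
Local Notation C := R[i].

Lemma adjmxE m n (A : 'M[C]_(m, n)) i j : adjmx A i j = Num.conj (A j i).
Proof. by rewrite !mxE. Qed.

Lemma adjmxM m n p (A : 'M[C]_(m, n)) (B : 'M[C]_(n, p)) :
  adjmx (A *m B) = adjmx B *m adjmx A.
Proof. by rewrite /adjmx trmx_mul map_mxM. Qed.

Lemma adjmxD m n (A B : 'M[C]_(m, n)) : adjmx (A + B) = adjmx A + adjmx B.
Proof. by rewrite /adjmx raddfD map_mxD. Qed.

Lemma adjmxN m n (A : 'M[C]_(m, n)) : adjmx (- A) = - adjmx A.
Proof. by rewrite /adjmx raddfN map_mxN. Qed.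

Lemma adjmxB m n (A B : 'M[C]_(m, n)) : adjmx (A - B) = adjmx A - adjmx B.
Proof. by rewrite adjmxD adjmxN. Qed.

Lemma adjmxZ m n (a : C) (A : 'M[C]_(m, n)) :
  adjmx (a *: A) = Num.conj a *: adjmx A.
Proof. by rewrite /adjmx linearZ map_mxZ. Qed.

Lemma adjmxK m n (A : 'M[C]_(m, n)) : adjmx (adjmx A) = A.
Proof. by apply/matrixP => i j; rewrite !adjmxE conjCK. Qed.

Lemma adjmx0 m n : adjmx (0 : 'M[C]_(m, n)) = 0.
Proof. by rewrite /adjmx trmx0 map_mx0. Qed.

Lemma adjmx1 n : adjmx (1%:M : 'M[C]_n) = 1%:M.
Proof. by rewrite /adjmx trmx1 map_mx1. Qed.

Lemma adjmx_sum (I : Type) (r : seq I) (P : pred I) m n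
    (F : I -> 'M[C]_(m, n)) :
  adjmx (\sum_(i <- r | P i) F i) = \sum_(i <- r | P i) adjmx (F i).
Proof.
exact: (big_morph _ (@adjmxD m n) (@adjmx0 m n)).
Qed.

Lemma mxtrace_adj n (A : 'M[C]_n) : \tr (adjmx A) = Num.conj (\tr A).
Proof. by rewrite /mxtrace rmorph_sum; apply: eq_bigr => i _; rewrite adjmxE. Qed.

Definition dotc n (u v : 'cV[C]_n) : C := (adjmx u *m v) 0 0.

Lemma dotcE n (u v : 'cV[C]_n) :
  dotc u v = \sum_a Num.conj (u a 0) * v a 0.
Proof. by rewrite /dotc mxE; apply: eq_bigr => a _; rewrite adjmxE. Qed.

Lemma dotcDl n (u v w : 'cV[C]_n) : dotc (u + v) w = dotc u w + dotc v w.
Proof. by rewrite /dotc adjmxD mulmxDl mxE. Qed.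

Lemma dotcDr n (u v w : 'cV[C]_n) : dotc u (v + w) = dotc u v + dotc u w.
Proof. by rewrite /dotc mulmxDr mxE. Qed.

Lemma dotcZl n a (u v : 'cV[C]_n) : dotc (a *: u) v = Num.conj a * dotc u v.
Proof. by rewrite /dotc adjmxZ -scalemxAl mxE. Qed.

Lemma dotcZr n a (u v : 'cV[C]_n) : dotc u (a *: v) = a * dotc u v.
Proof. by rewrite /dotc -scalemxAr mxE. Qed.

Lemma dotc0r n (u : 'cV[C]_n) : dotc u 0 = 0.
Proof. by rewrite /dotc mulmx0 mxE. Qed.

Lemma dotc_conj n (u v : 'cV[C]_n) : dotc v u = Num.conj (dotc u v).
Proof. by rewrite /dotc -adjmxE adjmxM adjmxK. Qed.

Lemma dotc_adj m n (M : 'M[C]_(m, n)) (u : 'cV[C]_n) (v : 'cV[C]_m) :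
  dotc (M *m u) v = dotc u (adjmx M *m v).
Proof. by rewrite /dotc adjmxM mulmxA. Qed.

Lemma dotc_ge0 n (v : 'cV[C]_n) : 0 <= dotc v v.
Proof.
by rewrite dotcE sumr_ge0// => a _; rewrite mulrC mul_conjC_ge0.
Qed.

Lemma dotc_delta n (M : 'M[C]_n) a b :
  dotc (delta_mx a 0) (M *m delta_mx b 0) = M a b.
Proof.
rewrite -colE dotcE (bigD1 a)//= !mxE !eqxx conjC1 mul1r big1 ?addr0// => i ia.
by rewrite mxE (negbTE ia) conjC0 mul0r.
Qed.

(** Each product [|v_a| |v_b|] is at most the squared norm of [v]. The constant is crude but depends
    on [N] alone, which suffices for bounds uniform in [n]. *)
Lemma norm_dotc_le n (N : 'M[C]_n) (v : 'cV[C]_n) :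
  `|dotc v (N *m v)| <= (\sum_a \sum_b `|N a b|) * dotc v v.
Proof.
have le1 a : `|v a 0| ^+ 2 <= dotc v v.
  rewrite normCK dotcE (bigD1 a)//= mulrC lerDl sumr_ge0// => i _.
  by rewrite mulrC mul_conjC_ge0.
have le2 a b : `|v a 0| * `|v b 0| <= dotc v v.
  case: (real_leP (normr_real (v a 0)) (normr_real (v b 0))) => h.
    by apply: le_trans (le1 b); rewrite expr2 ler_wpM2r.
  by apply: le_trans (le1 a); rewrite expr2 ler_wpM2l// ltW.
rewrite dotcE; apply: (le_trans (ler_norm_sum _ _ _)).
rewrite mulr_suml; apply: ler_sum => a _.
rewrite normrM norm_conjC mxE mulr_suml.
apply: (le_trans (ler_wpM2l (normr_ge0 _) (ler_norm_sum _ _ _))).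
rewrite mulr_sumr; apply: ler_sum => b _.
by rewrite normrM mulrCA ler_wpM2l.
Qed.

Lemma posmx_sesqui n (rho : 'M[C]_n) (u v : 'cV[C]_n) : posmx rho ->
  dotc v (rho *m u) = Num.conj (dotc u (rho *m v)) /\
  `|dotc u (rho *m v)| ^+ 2 <= dotc u (rho *m u) * dotc v (rho *m v).
Proof.
move=> rho_ge0.
have pos w : 0 <= dotc w (rho *m w) by rewrite /dotc mulmxA.
apply: cauchy_schwarz_quadratic => // z.
have := pos (u + z *: v).
by rewrite mulmxDr -scalemxAr !dotcDl !dotcDr !dotcZl !dotcZr !addrA mulrA.
Qed.

Lemma posmx_herm n (rho : 'M[C]_n) : posmx rho -> adjmx rho = rho.
Proof.
move=> rho_ge0; apply/matrixP => a b; rewrite adjmxE.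
have [+ _] := posmx_sesqui (delta_mx b 0) (delta_mx a 0) rho_ge0.
by rewrite !dotc_delta.
Qed.

Lemma herm_dotc_real n (s : 'M[C]_n) (v : 'cV[C]_n) : adjmx s = s ->
  dotc v (s *m v) \is Num.real.
Proof. by move=> sH; apply/CrealP; rewrite -dotc_conj dotc_adj sH. Qed.

(** Positivity makes [rho] invertible, so the coordinate [v_a] is the pairing of [u a] with [rho v],
    where [u a] is the adjoint of [rho^-1] applied to a basis vector. Cauchy-Schwarz for the form of
    [rho], summed over [a], gives the constant. *)
Lemma posdefmx_lower n (rho : 'M[C]_n) : posmx rho -> posdefmx rho ->
  exists2 c, 0 <= c & forall v, dotc v v <= c * dotc v (rho *m v).
Proof.
move=> rho_ge0 rho_gt0.
have pos w : 0 <= dotc w (rho *m w) by rewrite /dotc mulmxA.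
have rhoU : rho \in unitmx.
  rewrite unitmxE unitfE; apply/det0P => -[v v0 vrho].
  have := rho_gt0 (adjmx v).
  rewrite adjmxK vrho mul0mx mxE ltxx => /(_ _)/notF; apply.
  by apply: contra v0 => /eqP v0; rewrite -(adjmxK v) v0 adjmx0.
pose u a : 'cV[C]_n := adjmx (invmx rho) *m delta_mx a 0.
exists (\sum_a dotc (u a) (rho *m u a)) => [|v]; first exact: sumr_ge0.
rewrite {1}dotcE mulr_suml; apply: ler_sum => a _.
have [_] := posmx_sesqui (u a) v rho_ge0.
rewrite /u dotc_adj adjmxK mulKmx// normCK mulrC.
suff -> : dotc (delta_mx a 0) v = v a 0 by [].
rewrite dotcE (bigD1 a)//= !mxE !eqxx conjC1 mul1r big1 ?addr0// => i ia.
by rewrite mxE (negbTE ia) conjC0 mul0r.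
Qed.

End adjoint.

(** * Kraus blocks, the channel and its predual, fixed points, the Poisson equation *)

Section channel.
Context {R : realType} {d k : nat}.
Local Notation C := R[i].
Implicit Types (V W : 'M[C]_(d * k, d)) (N : 'M[C]_d).

Lemma big_mxtens (F : 'I_(d * k) -> C) :
  \sum_j F j = \sum_a \sum_i F (mxtens_index (a, i)).
Proof.
rewrite pair_bigA /= (reindex (@mxtens_index d k)) /=; last first.
  exists (@mxtens_unindex d k) => ? _; [exact: mxtens_indexK|].
  exact: mxtens_unindexK.
by apply: eq_bigr => -[].
Qed.

Lemma mulmx_kraus V W :
  adjmx V *m W = \sum_(i < k) adjmx (kraus V i) *m kraus W i.
Proof.
apply/matrixP => a b; rewrite !mxE summxE.
rewrite big_mxtens exchange_big /=; apply: eq_bigr => i _; rewrite mxE.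
by apply: eq_bigr => x _; rewrite !mxE.
Qed.

Lemma krausD V W i : kraus (V + W) i = kraus V i + kraus W i.
Proof. by apply/matrixP => a b; rewrite !mxE. Qed.

Lemma krausZ z V i : kraus (z *: V) i = z *: kraus V i.
Proof. by apply/matrixP => a b; rewrite !mxE. Qed.

Lemma krausN V i : kraus (- V) i = - kraus V i.
Proof. by apply/matrixP => a b; rewrite !mxE. Qed.

Lemma kraus_mulr V N i : kraus (V *m N) i = kraus V i *m N.
Proof.
by apply/matrixP => a b; rewrite !mxE; apply: eq_bigr => x _; rewrite mxE.
Qed.

Lemma kraus_tens N V i :
  kraus ((N *t (1%:M : 'M_k)) *m V) i = N *m kraus V i.
Proof.
apply/matrixP => a b; rewrite !mxE.
rewrite big_mxtens; apply: eq_bigr => x _; rewrite (bigD1 i)//= big1 => [|j ji].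
  by rewrite tensmxE !mxE eqxx mulr1 addr0.
by rewrite tensmxE mxE eq_sym (negbTE ji) mulr0 mul0r.
Qed.

Definition heis V N : 'M[C]_d :=
  \sum_(i < k) adjmx (kraus V i) *m N *m kraus V i.

Lemma heisE V N : heis V N = adjmx V *m ((N *t (1%:M : 'M_k)) *m V).
Proof.
by rewrite mulmx_kraus; apply: eq_bigr => i _; rewrite kraus_tens mulmxA.
Qed.

Lemma heis_is_linear V : linear (heis V).
Proof.
move=> a N M; rewrite /heis scaler_sumr -big_split; apply: eq_bigr => i _ /=.
by rewrite mulmxDr mulmxDl -scalemxAr -scalemxAl.
Qed.

HB.instance Definition _ V :=
  GRing.isLinear.Build C 'M[C]_d 'M[C]_d _ (heis V) (heis_is_linear V).

Lemma predual_is_linear V : linear (predual V).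
Proof.
move=> a N M; rewrite /predual scaler_sumr -big_split; apply: eq_bigr => i _ /=.
by rewrite mulmxDr mulmxDl -scalemxAr -scalemxAl.
Qed.

HB.instance Definition _ V :=
  GRing.isLinear.Build C 'M[C]_d 'M[C]_d _ (predual V) (predual_is_linear V).

Lemma heis_adj V N : adjmx (heis V N) = heis V (adjmx N).
Proof.
by rewrite adjmx_sum; apply: eq_bigr => i _; rewrite !adjmxM adjmxK mulmxA.
Qed.

Lemma predual_adj V N : adjmx (predual V N) = predual V (adjmx N).
Proof.
by rewrite adjmx_sum; apply: eq_bigr => i _; rewrite !adjmxM adjmxK mulmxA.
Qed.

Lemma heis1 V : is_isometry V -> heis V 1%:M = 1%:M.
Proof.
move=> VV; rewrite -[RHS]VV mulmx_kraus.
by apply: eq_bigr => i _; rewrite mulmx1.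
Qed.

Lemma mxtrace_heis V (s N : 'M[C]_d) :
  \tr (s *m heis V N) = \tr (predual V s *m N).
Proof.
rewrite mulmx_sumr mulmx_suml !raddf_sum; apply: eq_bigr => i _ /=.
by rewrite !mulmxA mxtrace_mulC !mulmxA.
Qed.

Lemma mxtrace_eq0 n (s : 'M[C]_n) : (forall P : 'M[C]_n, \tr (s *m P) = 0) -> s = 0.
Proof.
move=> s0; apply/matrixP => a b; have := s0 (delta_mx b a).
rewrite mxtrace_mulC /mxtrace (bigD1 b)//= big1 => [|i ib].
  rewrite addr0 mxE (bigD1 a)//= big1 => [|j ja].
    by rewrite !mxE !eqxx mul1r addr0.
  by rewrite mxE (negbTE ja) andbF mul0r.
by rewrite mxE big1// => j _; rewrite mxE (negbTE ib) mul0r.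
Qed.

Lemma irreducible_rho_ss V : irreducible V -> faithful_stationary V (rho_ss V).
Proof. by move=> [rho [rhoP _]]; apply: (xgetPex 0); exists rho. Qed.

(** For small [t > 0] the matrix [rho + t s] is again a faithful stationary state, hence equals
    [rho] by uniqueness. *)
Lemma predual_fixed_herm V s : irreducible V -> adjmx s = s ->
  predual V s = s -> \tr s = 0 -> s = 0.
Proof.
move=> irr sH sfix str; have rhoP := irreducible_rho_ss irr.
have rho_unique sigma : faithful_stationary V sigma -> sigma = rho_ss V.
  by case: irr => rho [_ H] sP; rewrite -(H _ sP); apply: H.
move: (rho_ss V) rhoP rho_unique => rho [[rho_ge0 rho_tr] rho_gt0 rho_fix] uniq.
have [c c0 cP] := posdefmx_lower rho_ge0 rho_gt0.
pose b := (\sum_i \sum_j `|s i j|) * c.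
have b0 : 0 <= b by rewrite mulr_ge0// sumr_ge0// => i _; rewrite sumr_ge0.
have b1 : 0 < b + 1 by rewrite ltr_wpDl.
(* The form of [s] is bounded by [b] times that of [rho], and this [t] satisfies [1 - t * b = t];
   hence [rho + t s] dominates [t rho]. *)
pose t := (b + 1)^-1.
have t0 : 0 < t by rewrite invr_gt0.
have pos v : 0 <= dotc v (rho *m v) by rewrite /dotc mulmxA.
have lower v : t * dotc v (rho *m v) <= dotc v ((rho + t *: s) *m v).
  rewrite mulmxDl -scalemxAl dotcDr dotcZr -lerBlDl.
  have -> : t * dotc v (rho *m v) - dotc v (rho *m v) =
      t * - (b * dotc v (rho *m v)).
    by rewrite /t; field; rewrite gt_eqF.
  rewrite ler_pM2l// lerNl.
  apply: (@le_trans _ _ `|dotc v (s *m v)|).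
    by rewrite -normrN real_ler_norm// rpredN herm_dotc_real.
  apply: (le_trans (norm_dotc_le _ _)); rewrite /b -mulrA ler_wpM2l//.
  by rewrite sumr_ge0// => i _; rewrite sumr_ge0.
have : rho + t *: s = rho.
  apply: uniq; split.
  - split=> [v|]; last by rewrite mxtraceD mxtraceZ str mulr0 addr0.
    rewrite -mulmxA; apply: le_trans (lower v).
    by rewrite mulr_ge0// ltW.
  - move=> v v0; rewrite -mulmxA; apply: lt_le_trans (lower v).
    by rewrite mulr_gt0// /dotc mulmxA rho_gt0.
  - by rewrite linearD linearZ /= rho_fix sfix.
move/eqP; rewrite -subr_eq0 addrAC subrr add0r scaler_eq0 gt_eqF//=.
by move/eqP.
Qed.

(** Both [s + s^*] and ['i] times [s - s^*] are hermitian, traceless and fixed, so the hermitian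
    case makes them vanish. *)
Lemma predual_fixed_tr0 V s : irreducible V ->
  predual V s = s -> \tr s = 0 -> s = 0.
Proof.
move=> irr sfix str.
have h1 : s + adjmx s = 0.
  apply: (predual_fixed_herm irr).
  - by rewrite adjmxD adjmxK addrC.
  - by rewrite linearD /= -predual_adj sfix.
  - by rewrite mxtraceD mxtrace_adj str conjC0 addr0.
have h2 : 'i *: (s - adjmx s) = 0.
  apply: (predual_fixed_herm irr).
  - by rewrite adjmxZ adjmxB adjmxK conjCi scaleNr -scalerN opprB.
  - by rewrite linearZ linearB /= -predual_adj sfix.
  - by rewrite mxtraceZ linearB /= mxtrace_adj str conjC0 subr0 mulr0.
move/eqP: h2; rewrite scaler_eq0 (negbTE (neq0Ci _)) /= => /eqP h2.
apply/eqP; rewrite -[_ == 0]/(false || (s == 0)).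
have <- : (2%:R == 0 :> C) = false by rewrite pnatr_eq0.
by rewrite -scaler_eq0 scaler_nat mulr2n -{2}(subrK (adjmx s) s) h2 add0r h1.
Qed.

(* The range of N |-> N - heis V N is the annihilator, for the trace pairing,
   of the fixed points of its transpose, which are the multiples of rho_ss V. *)
Lemma poisson_equation V M : irreducible V -> \tr (rho_ss V *m M) = 0 ->
  exists N, N - heis V N = M.
Proof.
move=> irr M0; have [[_ rho_tr] _ rho_fix] := irreducible_rho_ss irr.
pose L (N : 'M[C]_d) := N - heis V N.
have Llin : linear L by move=> a N P; rewrite /L linearP scalerBr opprD addrACA.
pose LL : {linear 'M[C]_d -> 'M[C]_d} :=
  HB.pack L (GRing.isLinear.Build _ _ _ _ L Llin).
suff /submxP[x xM] : (mxvec M <= lin_mx LL)%MS.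
  exists (vec_mx x); apply: (can_inj mxvecK).
  by rewrite xM -[in RHS](vec_mxK x) mul_vec_lin.
rewrite submxE; apply/eqP/matrixP => i j; rewrite ord1 mxE [RHS]mxE.
(* A column [c] of the cokernel is a functional vanishing on the range; [s] represents it through
   the trace pairing, whence the transposes. *)
pose c := col j (cokermx (lin_mx LL)).
have Lc : lin_mx LL *m c = 0 by rewrite /c colE mulmxA mulmx_coker mul0mx.
pose s : 'M[C]_d := (vec_mx c^T)^T.
have pairE N : (mxvec N *m c) 0 0 = \tr (s *m N).
  rewrite mxtrace_mulC /mxtrace mxE (reindex _ (curry_mxvec_bij _ _)) /=.
  under [RHS]eq_bigr do rewrite mxE.
  by rewrite pair_bigA; apply: eq_bigr => -[a b] _ /=; rewrite mxvecE !mxE.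
have s_fix : predual V s = s.
  apply/esym/eqP; rewrite -subr_eq0; apply/eqP/mxtrace_eq0 => N.
  rewrite mulmxBl linearB /= -mxtrace_heis -linearB -mulmxBr /= -pairE.
  by rewrite -[N - heis V N]/(LL N) -mul_vec_lin -mulmxA Lc mulmx0 mxE.
have -> : \sum_j0 mxvec M 0 j0 * cokermx (lin_mx LL) j0 j = (mxvec M *m c) 0 0.
  by rewrite mxE; apply: eq_bigr => l _; rewrite [in RHS]mxE.
rewrite pairE.
have -> : s = \tr s *: rho_ss V.
  apply/eqP; rewrite -subr_eq0; apply/eqP/(predual_fixed_tr0 irr).
    by rewrite linearB linearZ /= s_fix rho_fix.
  by rewrite linearB linearZ /= rho_tr mulr1 subrr.
by rewrite -scalemxAl mxtraceZ M0 mulr0.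
Qed.

End channel.

(** * System-output vectors: inner products and means over output sequences *)

Section output.
Context {R : realType} {d k : nat}.
Local Notation C := R[i].
Implicit Types (V A X Y : 'M[C]_(d * k, d)) (N K : 'M[C]_d).
Implicit Types (phi chi : 'cV[C]_d) (f g h : seq 'I_k -> 'cV[C]_d).

(** Amplitudes are functions of sequences of every length, so that induction can append one output
    with [rcons]; [inner n] selects the length. *)
Definition ket V phi (s : seq 'I_k) : 'cV[C]_d :=
  foldl (fun psi i => kraus V i *m psi) phi s.

(* The second component of the fold is, by the product rule, the derivative of
   V |-> ket V phi s at V in the direction A. *)
Definition dket V A phi (s : seq 'I_k) : 'cV[C]_d :=
  (foldl (fun p i => (kraus V i *m p.1, kraus V i *m p.2 + kraus A i *m p.1))
     (phi, 0) s).2.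

Lemma ket_rcons V phi s i : ket V phi (rcons s i) = kraus V i *m ket V phi s.
Proof. by rewrite /ket foldl_rcons. Qed.

Lemma dket_rcons V A phi s i :
  dket V A phi (rcons s i) = kraus V i *m dket V A phi s + kraus A i *m ket V phi s.
Proof.
rewrite /dket foldl_rcons /=; congr (_ + kraus A i *m _).
by elim/last_ind: s => //= s j IH; rewrite foldl_rcons ket_rcons /= IH.
Qed.

Definition inner n f g : C := \sum_(t : n.-tuple 'I_k) dotc (f t) (g t).

Lemma eq_inner n f f' g g' :
    (forall s, size s = n -> f s = f' s) -> (forall s, size s = n -> g s = g' s) ->
  inner n f g = inner n f' g'.
Proof. by move=> ff gg; apply: eq_bigr => t _; rewrite ff ?gg ?size_tuple. Qed.

Lemma inner0 f g : inner 0 f g = dotc (f [::]) (g [::]).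
Proof.
by rewrite /inner (big_pred1 [tuple]) // => t; apply/esym/eqP/tuple0.
Qed.

Lemma innerS n f g : inner n.+1 f g =
  \sum_(t : n.-tuple 'I_k) \sum_i dotc (f (rcons t i)) (g (rcons t i)).
Proof.
rewrite pair_bigA /= /inner.
rewrite (reindex (fun p : n.-tuple 'I_k * 'I_k => [tuple of rcons p.1 p.2])) //=.
apply: onW_bij; apply: inj_card_bij => [[t i] [u j] /(congr1 val)/= /rcons_inj[]|].
  by move=> /val_inj -> ->.
by rewrite card_prod !card_tuple expnSr.
Qed.

Lemma innerDl n f g h :
  inner n (fun s => f s + g s) h = inner n f h + inner n g h.
Proof. by rewrite -big_split; apply: eq_bigr => t _; rewrite dotcDl. Qed.

Lemma innerDr n f g h :
  inner n h (fun s => f s + g s) = inner n h f + inner n h g.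
Proof. by rewrite -big_split; apply: eq_bigr => t _; rewrite dotcDr. Qed.

Lemma innerZl n a f g : inner n (fun s => a *: f s) g = Num.conj a * inner n f g.
Proof. by rewrite mulr_sumr; apply: eq_bigr => t _; rewrite dotcZl. Qed.

Lemma innerZr n a f g : inner n f (fun s => a *: g s) = a * inner n f g.
Proof. by rewrite mulr_sumr; apply: eq_bigr => t _; rewrite dotcZr. Qed.

Lemma inner_conj n f g : inner n g f = Num.conj (inner n f g).
Proof. by rewrite rmorph_sum; apply: eq_bigr => t _; apply: dotc_conj. Qed.

Lemma inner_ge0 n f : 0 <= inner n f f.
Proof. by apply: sumr_ge0 => t _; apply: dotc_ge0. Qed.

Lemma cauchy_schwarz_inner n f g :
  `|inner n f g| ^+ 2 <= inner n f f * inner n g g.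
Proof.
suff [] : inner n g f = Num.conj (inner n f g) /\
  `|inner n f g| ^+ 2 <= inner n f f * inner n g g by [].
apply: cauchy_schwarz_quadratic => [|z]; first exact: inner_ge0.
have := inner_ge0 n (fun s => f s + z *: g s).
by rewrite innerDl !innerDr !innerZl !innerZr !addrA mulrA.
Qed.

Lemma inner_parallelogram n f g :
  inner n (fun s => f s + g s) (fun s => f s + g s) <=
  2 * (inner n f f + inner n g g).
Proof.
have := inner_ge0 n (fun s => f s + (-1) *: g s).
rewrite !innerDl !innerDr !innerZl !innerZr rmorphN1 => fg.
by rewrite -subr_ge0; congr (_ <= _): fg; ring.
Qed.

Lemma kraus_dotc A Y u v :
  \sum_i dotc (kraus A i *m u) (kraus Y i *m v) = dotc u (adjmx A *m Y *m v).
Proof.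
rewrite mulmx_kraus mulmx_suml [in RHS]/dotc mulmx_sumr summxE.
by apply: eq_bigr => i _; rewrite dotc_adj mulmxA.
Qed.

Definition expect V phi n N : C :=
  inner n (ket V phi) (fun s => N *m ket V phi s).

Lemma expectB V phi n N K :
  expect V phi n (N - K) = expect V phi n N - expect V phi n K.
Proof.
apply/eqP; rewrite eq_sym subr_eq -innerDr; apply/eqP; apply: eq_inner => // s _.
by rewrite -mulmxDl subrK.
Qed.

(** The last step of the evolution is moved onto the operator: summing over the last output
    contracts the Kraus blocks. *)
Lemma expect_heis V phi n N : expect V phi n.+1 N = expect V phi n (heis V N).
Proof.
rewrite /expect innerS; apply: eq_bigr => t _.
under eq_bigr do rewrite ket_rcons mulmxA -kraus_tens.
by rewrite kraus_dotc heisE.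
Qed.

Lemma inner_ket V phi n : is_isometry V ->
  inner n (ket V phi) (ket V phi) = dotc phi phi.
Proof.
move=> VV; elim: n => [|n IH]; first by rewrite inner0.
rewrite innerS -IH; apply: eq_bigr => t _.
under eq_bigr do rewrite !ket_rcons.
by rewrite kraus_dotc VV mul1mx.
Qed.

Lemma expect_scalar V phi n a : is_isometry V ->
  expect V phi n a%:M = a * dotc phi phi.
Proof.
move=> VV; rewrite -(inner_ket phi n VV) -innerZr.
by apply: eq_inner => // s _; rewrite mul_scalar_mx.
Qed.

Lemma norm_expect_le V phi n N : is_isometry V ->
  `|expect V phi n N| <= (\sum_a \sum_b `|N a b|) * dotc phi phi.
Proof.
move=> VV; rewrite -(inner_ket phi n VV) mulr_sumr.
apply: (le_trans (ler_norm_sum _ _ _)); apply: ler_sum => t _.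
exact: norm_dotc_le.
Qed.

Lemma inner_ket_dket V X phi chi n : is_isometry V -> adjmx V *m X = 0 ->
  inner n (ket V chi) (dket V X phi) = 0.
Proof.
move=> VV VX; elim: n => [|n IH]; first by rewrite inner0 dotc0r.
rewrite innerS -[RHS]IH; apply: eq_bigr => t _.
under eq_bigr do rewrite ket_rcons dket_rcons dotcDr.
by rewrite big_split /= !kraus_dotc VV VX mul1mx mul0mx dotc0r addr0.
Qed.

(** Insertions at two different outputs are orthogonal: at the later one [V^* Y] or [X^* V] appears,
    and both vanish. Insertions at the same output leave the mean of [X^* Y] in the state before
    it. *)
Lemma inner_dket V X Y phi n : is_isometry V ->
    adjmx V *m X = 0 -> adjmx V *m Y = 0 ->
  inner n (dket V X phi) (dket V Y phi) =
  \sum_(j < n) expect V phi j (adjmx X *m Y).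
Proof.
move=> VV VX VY.
have XV : adjmx X *m V = 0 by rewrite -[V]adjmxK -adjmxM VX adjmx0.
elim: n => [|n IH]; first by rewrite inner0 big_ord0 dotc0r.
rewrite big_ord_recr /= -IH innerS -big_split; apply: eq_bigr => t _ /=.
under eq_bigr do rewrite !dket_rcons dotcDl !dotcDr.
rewrite !big_split /= !kraus_dotc VV VY XV mul1mx !mul0mx.
by rewrite !dotc0r addr0 add0r.
Qed.

(** A [K] between two consecutive outputs arises from both with opposite signs, so only the initial
    and the final one survive; [theta] is collected once per output. *)
Lemma dket_nonid V X (theta : C) K phi s :
  dket V (X + (theta *: V - (K *t (1%:M : 'M_k)) *m V + V *m K)) phi s =
  dket V X phi s + ((theta * (size s)%:R) *: ket V phi s +
    (ket V (K *m phi) s + - K *m ket V phi s)).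
Proof.
elim/last_ind: s => [|s i IH].
  by rewrite /dket /ket /= mulr0 scale0r mulNmx subrr !addr0.
rewrite !dket_rcons !ket_rcons IH size_rcons.
rewrite !(krausD, krausN, krausZ, kraus_mulr, kraus_tens).
rewrite !(mulmxDl, mulmxDr, mulmxN, mulNmx) -!scalemxAl -!scalemxAr !mulmxA.
rewrite -[(size s).+1]addn1 natrD mulrDr mulr1 scalerDl.
move: (kraus V i *m dket _ _ _ _) (kraus V i *m ket _ _ _) (kraus X i *m _).
move: (kraus V i *m K *m _) (K *m _ *m _) (kraus V i *m ket _ _ _).
by move=> *; apply/colP => a; rewrite !mxE; ring.
Qed.

End output.

(** * The derivative of the state is ['i] times [dket] *)

Section derivative.
Context {R : realType} {d k : nat}.
Local Notation C := R[i].

(** Real and imaginary parts are real-linear maps [g]; applied to the polynomial in [u] they give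
    the real polynomial [part g], whose derivative at [0] is its coefficient of degree one. *)
Lemma cderive1_horner (p : {poly C}) :
  cderive1 (fun u : R => p.[0 +i* u]) 0 = 'i * p`_1.
Proof.
pose part (g : C -> R) : {poly R} := \poly_(j < size p) g (p`_j * 'i ^+ j).
have partE (g : C -> R) : (forall x y, g (x + y) = g x + g y) ->
    (forall x (u : R), g (x * u%:C) = g x * u) ->
    derive1 (fun u : R => g p.[0 +i* u]) 0 = g ('i * p`_1).
  move=> gD gM.
  have g0 : g 0 = 0 by apply: (addrI (g 0)); rewrite -gD !addr0.
  have -> : (fun u : R => g p.[0 +i* u]) = horner (part g).
    apply/funext => u; rewrite horner_poly horner_coef (big_morph g gD g0).
    apply: eq_bigr => j _; rewrite -gM; congr g.
    have -> : 0 +i* u = 'i * u%:C.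
      by rewrite -complexiE; simpc.
    by rewrite exprMn mulrA rmorphXn.
  rewrite -derivE horner_coef0 coef_deriv mulr1n coef_poly expr1 mulrC.
  by case: ltnP => // h; rewrite nth_default ?mulr0 ?g0.
rewrite /cderive1 !partE.
- by case: ('i * p`_1).
- by move=> [a b] [e f].
- by move=> [a b] u /=; rewrite mulr0 add0r.
- by move=> [a b] [e f].
- by move=> [a b] u /=; rewrite mulr0 subr0.
Qed.

(** Appending an output multiplies by a matrix with entries affine in [z], so coordinates stay
    polynomial, and their first two coefficients obey the recursions of [ket] and [dket]. *)
Lemma ket_line (V A : 'M[C]_(d * k, d)) phi s : exists p : 'I_d -> {poly C},
  forall a, [/\ forall z, ket (V + z *: A) phi s a 0 = (p a).[z],
    (p a)`_0 = ket V phi s a 0 & (p a)`_1 = dket V A phi s a 0].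
Proof.
elim/last_ind: s => [|s i [p pP]].
  exists (fun a => (phi a 0)%:P) => a.
  by split=> [z||]; rewrite ?hornerC// coefC//= mxE.
exists (fun a => \sum_b ((kraus V i a b)%:P + (kraus A i a b) *: 'X) * p b) => a.
split=> [z||].
- rewrite ket_rcons mxE horner_sum; apply: eq_bigr => b _.
  have [-> _ _] := pP b; rewrite krausD krausZ !mxE hornerM; congr (_ * _).
  by rewrite hornerD hornerC hornerZ hornerX mulrC.
- rewrite ket_rcons mxE coef_sum; apply: eq_bigr => b _.
  have [_ <- _] := pP b.
  by rewrite coef0M coefD coefC coefZ coefX mulr0 addr0.
- rewrite dket_rcons !mxE -big_split coef_sum; apply: eq_bigr => b _ /=.
  have [_ <- <-] := pP b.
  rewrite coefM big_ord_recl big_ord1 /= !coefD !coefC !coefZ !coefX /=.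
  by rewrite !mulr0 !mulr1 addr0 add0r.
Qed.

Lemma dsysout_stateE n (V A : 'M[C]_(d * k, d)) phi (t : n.-tuple 'I_k) :
  dsysout_state n phi V A t = 'i *: dket V A phi t.
Proof.
rewrite ffunE; apply/matrixP => a b; rewrite ord1 !mxE.
have [p /(_ a)[pz _ <-]] := ket_line V A phi t.
rewrite -cderive1_horner; congr (cderive1 _ 0); apply/funext => u.
by rewrite -pz ffunE.
Qed.

Lemma braket_inner n (Psi Phi : sysout R d k n) (f g : seq 'I_k -> 'cV[C]_d) :
    (forall t : n.-tuple 'I_k, Psi t = f t) ->
    (forall t : n.-tuple 'I_k, Phi t = g t) ->
  braket Psi Phi = inner n f g.
Proof. by move=> Pf Pg; apply: eq_bigr => t _; rewrite Pf Pg. Qed.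

(** Each derivative carries a factor ['i]; these factors pair up as ['i^* * 'i = 1]. *)
Lemma qfiE n (V A B : 'M[C]_(d * k, d)) phi :
  qfi n phi V A B = 4 * complex.Re (
    inner n (dket V A phi) (dket V B phi) -
    inner n (dket V A phi) (ket V phi) * inner n (ket V phi) (dket V B phi)).
Proof.
have ii : Num.conj 'i * 'i = 1 :> C by rewrite conjCi mulNr -expr2 sqrCi opprK.
rewrite /qfi; congr (4 * complex.Re _).
have psiE (t : n.-tuple 'I_k) : sysout_state n phi V t = ket V phi t.
  by rewrite ffunE.
have e1 : braket (dsysout_state n phi V A) (dsysout_state n phi V B) =
    Num.conj 'i * ('i * inner n (dket V A phi) (dket V B phi)).
  by rewrite -innerZr -innerZl; apply: braket_inner; exact: dsysout_stateE.
have e2 : braket (dsysout_state n phi V A) (sysout_state n phi V) =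
    Num.conj 'i * inner n (dket V A phi) (ket V phi).
  by rewrite -innerZl; apply: braket_inner => // t; exact: dsysout_stateE.
have e3 : braket (sysout_state n phi V) (dsysout_state n phi V B) =
    'i * inner n (ket V phi) (dket V B phi).
  by rewrite -innerZr; apply: braket_inner => // t; exact: dsysout_stateE.
by rewrite e1 e2 e3 mulrA mulrACA ii !mul1r.
Qed.

End derivative.

(** * Splitting a tangent vector into identifiable and nonidentifiable parts *)

Section decomposition.
Context {R : realType} {d k : nat}.
Local Notation C := R[i].
Variables (V : 'M[C]_(d * k, d)).
Hypotheses (VV : is_isometry V) (irr : irreducible V).

Lemma tangent_idE X : tangent_id V X -> adjmx V *m X = 0.
Proof.
move=> VVX; rewrite -[LHS]mul1mx -[X in X *m _]VV -mulmxA.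
by rewrite [V *m _]mulmxA VVX mulmx0.
Qed.

Lemma herm_pairing_real (s H : 'M[C]_d) : adjmx s = s -> adjmx H = H ->
  \tr (s *m H) \is Num.real.
Proof.
by move=> sH HH; apply/CrealP; rewrite -mxtrace_adj adjmxM sH HH mxtrace_mulC.
Qed.

(** A nonidentifiable [P] has [V^* P = theta + K - T(K)], so [V^* (A - P) = 0] is a Poisson equation
    for [K], solvable with [theta = Tr(rho V^* A)]. Tangency means that [V^* A] is hermitian, which
    makes [theta] real. *)
Lemma tangent_decomposition A : tangent V A ->
  exists X, tangent_id V X /\ tangent_nonid V (A - X).
Proof.
move=> /subr0_eq AV.
have [[rho_ge0 rho_tr] _ _] := irreducible_rho_ss irr.
have rhoH := posmx_herm rho_ge0.
set rho := rho_ss V in rho_tr rhoH *.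
have trS a : \tr (rho *m a%:M) = a.
  by rewrite mul_mx_scalar mxtraceZ rho_tr mulr1.
have HVA : adjmx (adjmx V *m A) = adjmx V *m A by rewrite adjmxM adjmxK.
pose theta := \tr (rho *m (adjmx V *m A)).
have thetaR : theta \is Num.real by exact: herm_pairing_real.
have [|N NP] := @poisson_equation _ _ _ V (adjmx V *m A - theta%:M) irr.
  by rewrite mulmxBr linearB /= trS subrr.
have scalarH a : a \is Num.real -> adjmx (a%:M : 'M[C]_d) = a%:M.
  by move=> /CrealP aR; rewrite -scalemx1 adjmxZ adjmx1 aR.
(* The right-hand side is hermitian, so [adjmx N] is a solution too, and the average of the two is a
   hermitian one. *)
have [H HH HP] : exists2 H, adjmx H = H & H - heis V H = adjmx V *m A - theta%:M.
  have NP' : adjmx N - heis V (adjmx N) = adjmx V *m A - theta%:M.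
    by rewrite -heis_adj -adjmxB NP adjmxB HVA scalarH.
  exists (2^-1 *: (N + adjmx N)).
    by rewrite adjmxZ adjmxD adjmxK addrC fmorphV rmorph_nat.
  have -> : heis V (2^-1 *: (N + adjmx N)) =
    2^-1 *: (heis V N + heis V (adjmx N)) by rewrite linearZ linearD.
  rewrite -scalerBr opprD addrACA NP NP' -mulr2n.
  move: (_ - _) => P; rewrite -[P *+ 2]scaler_nat.
  by rewrite scalerA mulVf ?scale1r// pnatr_eq0.
pose t := \tr (rho *m H).
have tR : t \is Num.real by exact: herm_pairing_real.
(* The shift achieves [Tr(rho K) = 0] and keeps the equation, the channel being unital. *)
pose K := H - t%:M.
have KP : K - heis V K = adjmx V *m A - theta%:M.
  have heis_t : heis V t%:M = t%:M by rewrite -scalemx1 linearZ /= heis1.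
  rewrite /K linearB /= heis_t -HP.
  by rewrite opprB addrA subrK.
exists (A - (theta *: V - (K *t (1%:M : 'M_k)) *m V + V *m K)); split.
  rewrite /tangent_id /= -mulmxA; set P := theta *: V - _ + _.
  suff -> : adjmx V *m (A - P) = 0 by rewrite mulmx0.
  rewrite mulmxBr /P mulmxDr mulmxBr -scalemxAr -heisE mulmxA VV mul1mx.
  by rewrite scalemx1 -addrA [_ + K]addrC KP addrC subrK subrr.
exists (complex.Re theta), K; split.
- by rewrite /K adjmxB HH (scalarH t tR).
- by rewrite mulmxBr linearB /= trS subrr.
- by rewrite RRe_real// opprB addrC subrK.
Qed.

Lemma idpartP A : tangent V A ->
  tangent_id V (idpart V A) /\ tangent_nonid V (A - idpart V A).
Proof.
move=> /tangent_decomposition AP.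
exact: (@xgetPex _ 0 [set X | tangent_id V X /\ tangent_nonid V (A - X)]).
Qed.

End decomposition.

(** Every term with [a] or [b] occurs both in [inner n f g] and in the product of overlaps, and
    cancels. In the application [a] and [b] are proportional to [n], so this removes the
    contribution of order [n^2]. *)
Lemma covariance_shift (R : realType) d k n
    (f g psi x y r q : seq 'I_k -> 'cV[R[i]]_d)
    (a b : R[i]) : Num.conj a = a ->
    inner n psi psi = 1 -> inner n x psi = 0 -> inner n psi y = 0 ->
    (forall s, size s = n -> f s = x s + (a *: psi s + r s)) ->
    (forall s, size s = n -> g s = y s + (b *: psi s + q s)) ->
  inner n f g - inner n f psi * inner n psi g = inner n x y +
    (inner n x q + (inner n r y + (inner n r q - inner n r psi * inner n psi q))).
Proof.
move=> aR psi1 xpsi psiy fE gE.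
rewrite (eq_inner fE gE) (eq_inner (g' := psi) fE)// (eq_inner (f' := psi) _ gE)//.
rewrite !(innerDl, innerDr, innerZl, innerZr) psi1 psiy xpsi aR; ring.
Qed.

(** * Growth in [n] and the limit *)

Section rate.
Context {R : realType} {d k : nat}.
Local Notation C := R[i].
Variables (V : 'M[C]_(d * k, d)) (phi : 'cV[C]_d).
Hypotheses (VV : is_isometry V) (irr : irreducible V) (phi1 : dotc phi phi = 1).

(** With [M - m = N - T(N)], each mean of [M] is [m] plus a difference of consecutive means of [N],
    and the sum telescopes. Single means may oscillate for a periodic channel; only their sum is
    controlled. *)
Lemma sum_expect (M : 'M[C]_d) : exists c, forall n,
  `|\sum_(j < n) expect V phi j M - n%:R * \tr (rho_ss V *m M)| <= c.
Proof.
have [[_ rho_tr] _ _] := irreducible_rho_ss irr.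
set m := \tr _.
have [|N NP] := @poisson_equation _ _ _ V (M - m%:M) irr.
  by rewrite mulmxBr linearB /= mul_mx_scalar mxtraceZ rho_tr mulr1 subrr.
have step j : expect V phi j M = m + (expect V phi j N - expect V phi j.+1 N).
  rewrite expect_heis -expectB NP expectB expect_scalar// phi1 mulr1.
  by rewrite addrC subrK.
exists (2 * (\sum_a \sum_b `|N a b|)) => n.
have -> : \sum_(j < n) expect V phi j M - n%:R * m =
    expect V phi 0 N - expect V phi n N.
  apply: (canLR (addrK _)); rewrite addrC.
  elim: n => [|n IH]; first by rewrite big_ord0 mul0r subrr addr0.
  by rewrite big_ord_recr /= IH step -natr1; ring.
rewrite mulr_natl mulr2n; apply: (le_trans (ler_normB _ _)).
by apply: lerD; have := norm_expect_le phi _ N VV; rewrite phi1 mulr1.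
Qed.

(** This is [O(sqrt n)], squared to match Cauchy-Schwarz. Index [0] is excluded so that bounded
    sequences qualify. *)
Definition sqrt_growth (f : nat -> C) :=
  exists c, forall n, (0 < n)%N -> `|f n| ^+ 2 <= c * n%:R.

Lemma sqrt_growthD f g :
  sqrt_growth f -> sqrt_growth g -> sqrt_growth (fun n => f n + g n).
Proof.
move=> [a fa] [b gb]; exists (2 * (a + b)) => n n0.
apply: (@le_trans _ _ (2 * (`|f n| ^+ 2 + `|g n| ^+ 2))).
  rewrite -subr_ge0; have : 0 <= `|f n - g n| ^+ 2 by rewrite exprn_ge0.
  by rewrite !normCK rmorphB rmorphD /=; congr (_ <= _); ring.
by rewrite -mulrA ler_pM2l// mulrDl lerD ?fa ?gb.
Qed.

Lemma sqrt_growth_bounded f c : (forall n, `|f n| ^+ 2 <= c) -> sqrt_growth f.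
Proof.
move=> fc; exists c => n n0; apply: (le_trans (fc n)).
by rewrite ler_peMr ?ler1n// (le_trans _ (fc 0))// exprn_ge0.
Qed.

Lemma inner_dket_le X : adjmx V *m X = 0 ->
  exists2 c, 0 <= c & forall n, inner n (dket V X phi) (dket V X phi) <= c * n%:R.
Proof.
move=> VX; exists (\sum_a \sum_b `|(adjmx X *m X) a b|) => [|n].
  by rewrite sumr_ge0// => a _; rewrite sumr_ge0.
rewrite -[leLHS]ger0_norm ?inner_ge0// inner_dket//.
apply: (le_trans (ler_norm_sum _ _ _)).
rewrite mulr_natr -[n in leRHS]card_ord -sumr_const; apply: ler_sum => j _.
by have := norm_expect_le phi j (adjmx X *m X) VV; rewrite phi1 mulr1.
Qed.

(** The remainder left by the telescoping in [dket_nonid]. *)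
Definition boundary (K : 'M[C]_d) (s : seq 'I_k) : 'cV[C]_d :=
  ket V (K *m phi) s + - K *m ket V phi s.

(** The isometry preserves the norm of [K phi], and the squared norm of the other term is a mean of
    [K^* K]. *)
Lemma boundary_le (K : 'M[C]_d) : exists2 c, 0 <= c & forall n,
  inner n (boundary K) (boundary K) <= c.
Proof.
exists (2 * (dotc (K *m phi) (K *m phi) +
        \sum_a \sum_b `|(adjmx (- K) *m - K) a b|)) => [|n].
  rewrite mulr_ge0// addr_ge0 ?dotc_ge0// sumr_ge0// => a _.
  by rewrite sumr_ge0.
apply: (le_trans (inner_parallelogram _ _ _)).
rewrite ler_pM2l// inner_ket// lerD2l.
set e := inner n _ _; have eE : e = expect V phi n (adjmx (- K) *m - K).
  by apply: eq_bigr => t _; rewrite dotc_adj mulmxA.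
rewrite -[e]ger0_norm ?inner_ge0// eE.
by have := norm_expect_le phi n (adjmx (- K) *m - K) VV; rewrite phi1 mulr1.
Qed.

Lemma covariance_growth A B X Y :
    tangent_id V X -> tangent_nonid V (A - X) ->
    tangent_id V Y -> tangent_nonid V (B - Y) ->
  sqrt_growth (fun n => inner n (dket V A phi) (dket V B phi) -
    inner n (dket V A phi) (ket V phi) * inner n (ket V phi) (dket V B phi) -
    n%:R * \tr (rho_ss V *m adjmx X *m Y)).
Proof.
move=> /(tangent_idE VV) VX [a [K [_ _ AX]]] /(tangent_idE VV) VY [b [L [_ _ BY]]].
pose x := dket V X phi; pose y := dket V Y phi; pose psi := ket V phi.
pose r := boundary K; pose q := boundary L.
have conjR (u : R) : Num.conj u%:C = u%:C.
  by apply/CrealP/complex_realP; exists u.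
have Ax n s : size s = n -> dket V A phi s = x s + ((a%:C * n%:R) *: psi s + r s).
  by move=> <-; rewrite -(subrK X A) AX addrC dket_nonid.
have By n s : size s = n -> dket V B phi s = y s + ((b%:C * n%:R) *: psi s + q s).
  by move=> <-; rewrite -(subrK Y B) BY addrC dket_nonid.
have psi1 n : inner n psi psi = 1 by rewrite inner_ket.
have psiy n : inner n psi y = 0 by rewrite inner_ket_dket.
have xpsi n : inner n x psi = 0 by rewrite inner_conj inner_ket_dket// conjC0.
have E n : inner n (dket V A phi) (dket V B phi) -
    inner n (dket V A phi) (ket V phi) * inner n (ket V phi) (dket V B phi) -
    n%:R * \tr (rho_ss V *m adjmx X *m Y) =
    (inner n x y - n%:R * \tr (rho_ss V *m (adjmx X *m Y))) +
    (inner n x q + (inner n r y + (inner n r q - inner n r psi * inner n psi q))).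
  have aR : Num.conj (a%:C * n%:R) = a%:C * n%:R.
    by rewrite rmorphM rmorph_nat /= conjR.
  have cov := covariance_shift aR (psi1 n) (xpsi n) (psiy n) (Ax n) (By n).
  by rewrite -mulmxA [RHS]addrAC; apply: (congr1 (fun u => u - _) cov).
have [c1 c1P] := sum_expect (adjmx X *m Y).
have [cx cx0 cxP] := inner_dket_le VX.
have [cy cy0 cyP] := inner_dket_le VY.
have [cr cr0 crP] := boundary_le K.
have [cq cq0 cqP] := boundary_le L.
(* The pairing of [x] with [y] is within a constant of its linear part. Those of [x] with [q] and
   [r] with [y] are [O(sqrt n)]: one factor has norm [O(sqrt n)], the other is bounded. The terms in
   [r], [q], [psi] alone are bounded. *)
rewrite (funext E); apply: sqrt_growthD.
  apply: (@sqrt_growth_bounded _ (c1 ^+ 2)) => n; rewrite /x /y inner_dket//.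
  by rewrite lerXn2r ?nnegrE// (le_trans _ (c1P n)).
apply: sqrt_growthD.
  exists (cx * cq) => n _; apply: (le_trans (cauchy_schwarz_inner _ _ _)).
  rewrite mulrAC; apply: ler_pM; [exact: inner_ge0|exact: inner_ge0|exact: cxP|exact: cqP].
apply: sqrt_growthD.
  exists (cr * cy) => n _; apply: (le_trans (cauchy_schwarz_inner _ _ _)).
  rewrite -mulrA; apply: ler_pM; [exact: inner_ge0|exact: inner_ge0|exact: crP|exact: cyP].
apply: sqrt_growthD.
  apply: (@sqrt_growth_bounded _ (cr * cq)) => n.
  apply: (le_trans (cauchy_schwarz_inner _ _ _)).
  by apply: ler_pM; [exact: inner_ge0|exact: inner_ge0|exact: crP|exact: cqP].
apply: (@sqrt_growth_bounded _ (cr * cq)) => n.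
rewrite normrN normrM exprMn ler_pM ?exprn_ge0//.
  apply: (le_trans (cauchy_schwarz_inner _ _ _)).
  by rewrite psi1 mulr1 crP.
apply: (le_trans (cauchy_schwarz_inner _ _ _)).
by rewrite psi1 mul1r cqP.
Qed.

Lemma sqrt_growth_cvg (f : nat -> C) (m : C) :
    sqrt_growth (fun n => f n - n%:R * m) ->
  (fun n => 4 * complex.Re (f n) / n%:R) @ \oo --> 4 * complex.Re m.
Proof.
move=> [c fP].
have c0 : 0 <= c.
  by have := fP 1%N isT; rewrite mulr1; apply: le_trans; rewrite exprn_ge0.
have [b cb] : exists b, c = b%:C by apply/complex_realP; exact: ger0_real.
have ReB (u v : C) : complex.Re (u - v) = complex.Re u - complex.Re v.
  by case: u v => [? ?] [? ?].
have ReM (n : nat) (u : C) : complex.Re (n%:R * u) = n%:R * complex.Re u.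
  rewrite -(rmorph_nat (real_complex R)).
  by case: u => p q /=; rewrite mul0r subr0.
have fR n : (0 < n)%N ->
    (complex.Re (f n) - n%:R * complex.Re m) ^+ 2 <= b * n%:R.
  move=> /fP; rewrite -ReM -ReB -add_Re2_Im2 cb -(rmorph_nat (real_complex R)).
  rewrite -rmorphM lecR; apply: le_trans.
  by rewrite lerDl sqr_ge0.
apply/cvgrPdist_le => e e0; near=> n.
have n0 : (0 < n)%N by near: n; exact: nbhs_infty_gt.
have n0' : 0 < n%:R :> R by rewrite ltr0n.
(* Squares are compared because [fR] bounds a square: the squared error is at most [16 * b / n],
   hence at most [e ^+ 2] once [n >= 16 * b / e ^+ 2]. *)
rewrite -ler_sqr ?nnegrE ?(ltW e0)//.
rewrite real_normK ?num_real//.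
have -> : 4 * complex.Re m - 4 * complex.Re (f n) / n%:R =
    - (4 / n%:R) * (complex.Re (f n) - n%:R * complex.Re m).
  by field; rewrite gt_eqF.
rewrite exprMn sqrrN.
apply: (le_trans (ler_wpM2l (sqr_ge0 _) (fR _ n0))).
have -> : (4 / n%:R) ^+ 2 * (b * n%:R) = 16 * b / n%:R by field; rewrite gt_eqF.
rewrite ler_pdivrMr// [_ * n%:R]mulrC -ler_pdivrMr ?exprn_gt0//.
by near: n; exact: nbhs_infty_ger.
Unshelve. all: by end_near. Qed.

End rate.

Theorem proposition6 (R : realType) (d k : nat) (V0 : 'M[R[i]]_(d * k, d))
    (hV0 : is_isometry V0) (irrV0 : irreducible V0)
    (phi : 'cV[R[i]]_d) (hphi : (adjmx phi *m phi) 0 0 = 1)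
    (eps : R) (heps : 0 < eps) (A B : 'M[R[i]]_(d * k, d))
    (hA : tangent_ball V0 eps A) (hB : tangent_ball V0 eps B) :
  (fun n : nat => qfi n phi V0 A B / n%:R) @ \oo -->
    qfi_rate V0 (idpart V0 A) (idpart V0 B).
Proof.
have [XA AX] := idpartP hV0 irrV0 hA.1.
have [YB BY] := idpartP hV0 irrV0 hB.1.
under eq_fun do rewrite qfiE.
exact: sqrt_growth_cvg (covariance_growth hV0 irrV0 hphi XA AX YB BY).
Qed.
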